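(* Let $n$ be a positive integer, let $\mathbf{z} = (z_1,\ldots,z_n)\in \mathbb{C}^n$ and let $\mathbf{J} = \mathbf{J}(\mathbf{z})$ be the Jacobian matrix at $\mathbf{z}$ of the map $\theta\colon\mathbb{C}^n\to\mathbb{C}^n$ defined in the context. The Jacobian determinant factors as \[ \det \mathbf{J} = \frac{1}{n!} \left( \prod_{j\in [n]} (-z_j)\right) \left( \prod_{\substack{j,k\in [n]\\ j\neq k}} (z_k-z_j)\right), \] where the last product runs over all ordered pairs $(j,k)$ with $j\neq k$. Thus $\mathbf{J}$ is invertible if and only if $z_1,\ldots, z_n$ are distinct and nonzero.
   Context: For a positive integer $n$, $[n]=\{1,\ldots,n\}$. For $\mathbf{z}=(z_1,\ldots,z_n)\in\mathbb{C}^n$ let $p(z)=p_{\mathbf{z}}(z)=\int_0^z (w-z_1)\cdots(w-z_n)\,dw$. The map $\theta\colon\mathbb{C}^n\to\mathbb{C}^n$ sends $\mathbf{z}$ to $\theta(\mathbf{z})=(\theta_1(\mathbf{z}),\ldots,\theta_n(\mathbf{z}))=(p_{\mathbf{z}}(z_1),\ldots,p_{\mathbf{z}}(z_n))$. The Jacobian matrix $\mathbf{J}=\mathbf{J}(\mathbf{z})$ is the $n\times n$ matrix with $(i,j)$-entry $\frac{\partial}{\partial z_i}\theta_j(\mathbf{z})=\frac{\partial}{\partial z_i}p(z_j)$, where $p(z_j)=p_{\mathbf{z}}(z_j)$ is regarded as a function of all of $z_1,\ldots,z_n$ (both through the coefficients of $p_{\mathbf{z}}$ and through the evaluation point). *)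

(* Defs.v *)
(* The complex numbers are R[i] for an arbitrary R : realType. *)
From mathcomp Require Import all_boot all_order all_algebra.
From mathcomp Require Import all_classical all_reals all_analysis.
From mathcomp Require Import complex.

Set Implicit Arguments.
Unset Strict Implicit.
Unset Printing Implicit Defensive.

Import Order.TTheory GRing.Theory Num.Theory numFieldNormedType.Exports.
Local Open Scope classical_set_scope.
Local Open Scope ring_scope.
Local Open Scope complex_scope.

(* Complex line integral of f along the straight path t |-> a + t (b - a),
   t in [0, 1], computed on real and imaginary parts. For entire f (the only
   use below) the choice of the path from a to b is immaterial. *)
Definition line_integral (R : realType) (f : R[i] -> R[i]) (a b : R[i]) :
    R[i] :=
  let g (t : R) : R[i] := f (a + t%:C * (b - a)) * (b - a) in
  (\int[lebesgue_measure]_(t in `[0%R, 1%R]) complex.Re (g t))%R +i*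
  (\int[lebesgue_measure]_(t in `[0%R, 1%R]) complex.Im (g t))%R.

Definition crit_poly (R : realType) (n : nat) (z : 'rV[R[i]]_n) (x : R[i]) :
    R[i] :=
  line_integral (fun w : R[i] => \prod_(k < n) (w - z 0 k)) 0 x.

Definition theta (R : realType) (n : nat) (z : 'rV[R[i]]_n) : 'rV[R[i]]_n :=
  \row_(j < n) crit_poly z (z 0 j).

(* Complex partial derivatives: scalars in 'D_v range over R[i], and R[i]^o is
   R[i] as a normed space over itself. The row index is the variable and the
   column index the component of theta. *)
Definition theta_jacobian (R : realType) (n : nat) (z : 'rV[R[i]]_n) :
    'M[R[i]]_n :=
  \matrix_(i < n, j < n)
    'D_(delta_mx 0 i) (fun y : 'rV[R[i]]_n => theta y 0 j : (R[i])^o) z.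

(* Main.v *)
Require Import Defs.
From mathcomp Require Import all_boot all_order all_algebra.
From mathcomp Require Import all_classical all_reals all_analysis.
From mathcomp Require Import complex.

(** Since the polynomial p_z is a primitive of the product of all w - z_k,
    its derivative vanishes at every z_j. So the evaluation point contributes
    nothing to the partial derivative of p_z(z_j) in z_i, and differentiating
    the integrand, which is affine in z_i, leaves
      J_ij = - (integral from 0 to z_j of q_i),
    where q_i is the product of the w - z_k over k != i
    ([theta_jacobianE]).

    Each q_i has degree n - 1. Integrating it monomial by monomial factors the
    Jacobian as J = C D V diag(- z) ([theta_jacobian_factor]), where C is the
    matrix of the coefficients of the q_i, D = diag(1 / (m + 1)) for m < n,
    and V is the Vandermonde matrix with entries z_j ^ m. Its determinant is
    therefore (1 / n!) (prod_j - z_j) det(C V). But C V has entries q_i(z_j),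
    which vanish for i != j: it is the diagonal matrix of the q_i(z_i)
    ([coef_prod_but_Vandermonde]), and the product of the q_i(z_i) is the
    product of all differences over ordered pairs.

    The analysis enters twice, each time for polynomials: the line integral of
    a polynomial is the value of its formal primitive
    ([line_integral_horner]), and a function whose increment along v is
    h q(h) for a polynomial q has directional derivative q(0)
    ([derive_polynomial_increment]). *)

Set Implicit Arguments.
Unset Strict Implicit.
Unset Printing Implicit Defensive.

Import Order.TTheory GRing.Theory Num.Theory numFieldNormedType.Exports.
Local Open Scope ring_scope.
Local Open Scope complex_scope.

(** * Formal primitives of polynomials *)

(** The constant coefficient is p`_0 / 0, which is 0 by the convention on the
    inverse of 0, so this is the primitive that vanishes at 0. *)
Definition primitive (F : fieldType) (p : {poly F}) : {poly F} :=
  \poly_(i < (size p).+1) (p`_i.-1 / i%:R).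

Lemma coef_primitive (F : fieldType) (p : {poly F}) (i : nat) :
  (primitive p)`_i = p`_i.-1 / i%:R.
Proof.
rewrite coef_poly ltnS; case: leqP => // lt_p_i.
by rewrite nth_default ?mul0r// -ltnS (ltn_predK lt_p_i).
Qed.

Lemma deriv_primitive (F : numFieldType) (p : {poly F}) : (primitive p)^`() = p.
Proof.
apply/polyP => i; rewrite coef_deriv coef_primitive -[_ *+ _]mulr_natr.
by rewrite divfK// pnatr_eq0.
Qed.

Lemma horner_primitive (F : fieldType) (p : {poly F}) (n : nat) (x : F) :
  (size p <= n)%N ->
  (primitive p).[x] = \sum_(i < n) p`_i * i.+1%:R^-1 * x ^+ i.+1.
Proof.
move=> le_p_n; rewrite (@horner_coef_wide _ n.+1); last first.
  by rewrite (leq_trans (size_poly _ _)).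
rewrite big_ord_recl coef_primitive invr0 mulr0 mul0r add0r.
by apply: eq_bigr => i _; rewrite coef_primitive.
Qed.

Lemma primitiveBC (F : fieldType) (p q : {poly F}) (h : F) :
  primitive (p - h%:P * q) = primitive p - h%:P * primitive q.
Proof.
by apply/polyP => i; rewrite !(coef_primitive, coefB, coefCM) mulrBl mulrA.
Qed.

(** * Line integrals of polynomials *)

Lemma Rintegral_horner01 (R : realType) (p : {poly R}) :
  \int[lebesgue_measure]_(t in `[0%R, 1%R]%classic) p.[t] = (primitive p).[1].
Proof.
have P0 : (primitive p).[0] = 0.
  by rewrite horner_coef0 coef_primitive invr0 mulr0.
rewrite /Rintegral (@continuous_FTC2 _ _ (horner (primitive p)))//.
- by rewrite P0 sube0.
- by apply: continuous_subspaceT => x; exact: continuous_horner.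
- split; first by move=> x _; exact: derivable_horner.
  + by apply: cvg_at_right_filter; exact: continuous_horner.
  + by apply: cvg_at_left_filter; exact: continuous_horner.
- by move=> x _; rewrite -derivE deriv_primitive.
Qed.

(** An R-linear phi turns the integrand, a polynomial in the real parameter t
    with complex coefficients, into a real polynomial in t. Stating this for
    any phi treats the real and the imaginary part together. *)
Lemma Rintegral_real_linear_segment (R : realType) (phi : R[i] -> R)
    (p : {poly R[i]}) (x : R[i]) :
  {morph phi : u v / u + v} -> (forall (t : R) u, phi (t%:C * u) = t * phi u) ->
  \int[lebesgue_measure]_(t in `[0%R, 1%R]%classic)
     phi (p.[0 + t%:C * (x - 0)] * (x - 0)) = phi (primitive p).[x].
Proof.
move=> phiD phiZ.
have phi0 : phi 0 = 0 by have := phiZ 0 0; rewrite mulr0 mul0r.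
pose P := \poly_(i < size p) phi (p`_i * x ^+ i.+1).
transitivity (\int[lebesgue_measure]_(t in `[0%R, 1%R]%classic) P.[t]).
  apply: eq_Rintegral => t _; rewrite subr0 add0r horner_coef mulr_suml.
  rewrite horner_poly (big_morph phi phiD phi0); apply: eq_bigr => i _.
  rewrite exprMn -rmorphXn.
  have -> : p`_i * ((t ^+ i)%:C * x ^+ i) * x =
            (t ^+ i)%:C * (p`_i * x ^+ i.+1).
    by rewrite mulrCA -!mulrA -exprSr.
  by rewrite phiZ mulrC.
rewrite Rintegral_horner01 !(@horner_primitive _ _ (size p)) ?size_poly//.
rewrite (big_morph phi phiD phi0); apply: eq_bigr => i _.
rewrite expr1n mulr1 coef_poly ltn_ord mulrAC.
by rewrite -(rmorph_nat (real_complex R)) -fmorphV [in RHS]mulrC phiZ mulrC.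
Qed.

Lemma line_integral_horner (R : realType) (p : {poly R[i]}) (x : R[i]) :
  line_integral (horner p) 0 x = (primitive p).[x].
Proof.
rewrite /line_integral !Rintegral_real_linear_segment.
- by case: (primitive p).[x].
- by case=> a b [c d].
- by move=> t [a b]; rewrite /= mul0r addr0.
- by case=> a b [c d].
- by move=> t [a b]; rewrite /= mul0r subr0.
Qed.

Lemma crit_polyE (R : realType) n (z : 'rV[R[i]]_n) (x : R[i]) :
  crit_poly z x = (primitive (\prod_(k < n) ('X - (z 0 k)%:P))).[x].
Proof.
rewrite -line_integral_horner; congr line_integral; apply/funext => w.
by rewrite horner_prod; apply: eq_bigr => k _; rewrite hornerXsubC.
Qed.

(** * Directional derivatives with polynomial increments *)

Lemma continuous_horner_numField (F : numFieldType) (p : {poly F}) :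
  continuous (fun x : F => p.[x]).
Proof.
elim/poly_ind: p => [|p c IH] x.
  rewrite (_ : (fun x => _) = cst 0); first exact: cst_continuous.
  by apply/funext => y; rewrite horner0.
rewrite (_ : (fun x => _) = (fun y => p.[y] * y + c)); last first.
  by apply/funext => y; rewrite !hornerE.
apply: (@continuousD F F^o F (fun y => p.[y] * y) (cst c)).
  by apply: (@continuousM F F (horner p) id); [exact: IH|exact: cvg_id].
exact: cst_continuous.
Qed.

Lemma derive_polynomial_increment (F : numFieldType) (V : normedModType F)
    (f : V -> F^o) (a v : V) (q : {poly F}) :
  (forall h : F, f (h *: v + a) = f a + h * q.[h]) -> 'D_v f a = q.[0].
Proof.
move=> fE; apply: (@cvg_lim F^o); first exact: norm_hausdorff.
have qcvg : (q.[h] @[h --> (0 : F)^'] --> (q.[0] : F^o))%classic.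
  by apply: cvg_within_filter; exact: continuous_horner_numField.
apply: cvg_trans qcvg; apply: near_eq_cvg; near=> h.
have h0 : h != 0 by near: h; exact: nbhs_dnbhs_neq.
by rewrite /= fE addrAC subrr add0r; exact/esym/mulKf.
Unshelve. all: by end_near. Qed.

(** * The entries of the Jacobian matrix *)

Definition prod_but (F : fieldType) n (z : 'rV[F]_n) (i : 'I_n) : {poly F} :=
  \prod_(k < n | k != i) ('X - (z 0 k)%:P).

Lemma size_prod_but (F : fieldType) n (z : 'rV[F]_n) (i : 'I_n) :
  size (prod_but z i) = n.
Proof.
rewrite /prod_but -big_filter size_prod_XsubC -sum1_size big_filter.
by rewrite sum1_card cardC1 card_ord (ltn_predK (ltn_ord i)).
Qed.

Lemma horner_prod_but (F : fieldType) n (z : 'rV[F]_n) (i j : 'I_n) :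
  (prod_but z i).[z 0 j] =
  (\prod_(k < n | k != i) (z 0 i - z 0 k)) *+ (i == j).
Proof.
rewrite horner_prod; case: eqVneq => [<-|neq_ij].
  by apply: eq_bigr => k _; rewrite hornerXsubC.
by rewrite (bigD1 j) 1?eq_sym//= hornerXsubC subrr mul0r.
Qed.

(** Moving z by h along the i-th axis replaces p = (X - z_i) q_i by
    p - h q_i and the evaluation point z_j by z_j + h [i == j]. The resulting
    value is polynomial in h; its linear coefficient gets - (primitive q_i)(z_j)
    from the first change and [i == j] p(z_j) = 0 from the second. *)
Lemma theta_jacobianE (R : realType) n (z : 'rV[R[i]]_n) (i j : 'I_n) :
  theta_jacobian z i j = - (primitive (prod_but z i)).[z 0 j].
Proof.
rewrite mxE.
pose p := \prod_(k < n) ('X - (z 0 k)%:P).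
have pE k : p = ('X - (z 0 k)%:P) * prod_but z k by rewrite /p (bigD1 k).
have thetaE h : theta (h *: delta_mx 0 i + z) 0 j =
    (primitive p - h%:P * primitive (prod_but z i)).[z 0 j + h * (i == j)%:R].
  rewrite mxE crit_polyE !mxE eqxx /= eq_sym addrC -primitiveBC.
  congr (primitive _).[_].
  rewrite (bigD1 i)//= !mxE !eqxx mulr1 [in RHS](pE i).
  rewrite [X in _ * X](_ : _ = prod_but z i); last first.
    by apply: eq_bigr => k ki; rewrite !mxE (negPf ki) andbF mulr0 add0r.
  by rewrite -mulrBl polyCD opprD addrA addrAC.
(* T is the difference quotient of primitive p at z_j; its value there is the
   derivative of primitive p, that is p(z_j) = 0. *)
have [T TE] : exists T,
    primitive p - (primitive p).[z 0 j]%:P = T * ('X - (z 0 j)%:P).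
  by apply/factor_theorem; rewrite /root !hornerE subrr.
have Tz : T.[z 0 j] = 0.
  have /(congr1 (fun q => q^`().[z 0 j])) := TE.
  rewrite derivB derivC subr0 deriv_primitive derivM derivXsubC !hornerE subrr.
  by rewrite mulr0 add0r => <-; rewrite (pE j) !hornerE subrr mul0r.
pose L : {poly R[i]} := (i == j)%:R *: 'X + (z 0 j)%:P.
have LE h : L.[h] = z 0 j + h * (i == j)%:R.
  by rewrite /L !hornerE mulrC addrC.
pose G := (i == j)%:R *: (T \Po L) - (primitive (prod_but z i) \Po L).
have GE h :
    G.[h] = (i == j)%:R * T.[L.[h]] - (primitive (prod_but z i)).[L.[h]].
  by rewrite /G hornerD hornerN hornerZ !horner_comp.
have -> : - (primitive (prod_but z i)).[z 0 j] = G.[0].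
  by rewrite GE LE mul0r addr0 Tz mulr0 sub0r.
apply: derive_polynomial_increment => h.
have -> : theta z 0 j = (primitive p).[z 0 j] by rewrite mxE crit_polyE.
rewrite thetaE GE LE !hornerE.
have /(congr1 (fun q => q.[z 0 j + h * (i == j)%:R])) := TE.
rewrite !hornerE [X in T.[_] * X]addrAC subrr add0r => /eqP.
rewrite subr_eq => /eqP ->.
by rewrite mulrBr -addrA addrCA [_ * T.[_]]mulrC mulrCA addrA.
Qed.

(** * Factorization and determinant *)

Lemma theta_jacobian_factor (R : realType) n (z : 'rV[R[i]]_n) :
  theta_jacobian z =
    (\matrix_(i < n, m < n) (prod_but z i)`_m) *m
    diag_mx (\row_(m < n) m.+1%:R^-1) *m Vandermonde n z *m diag_mx (- z).
Proof.
apply/matrixP => i j; rewrite theta_jacobianE mul_mx_diag !mxE mulrN mulr_suml.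
rewrite (@horner_primitive _ _ n) ?size_prod_but//; congr (- _).
apply: eq_bigr => m _.
by rewrite mul_mx_diag !mxE exprSr mulrA.
Qed.

(** Multiplying coefficient rows by the Vandermonde matrix evaluates at the z_j,
    and q_i contains the factor w - z_j for every j != i. *)
Lemma coef_prod_but_Vandermonde (F : fieldType) n (z : 'rV[F]_n) :
  (\matrix_(i < n, m < n) (prod_but z i)`_m) *m Vandermonde n z =
  diag_mx (\row_(i < n) \prod_(k < n | k != i) (z 0 i - z 0 k)).
Proof.
apply/matrixP => i j; rewrite !mxE -horner_prod_but.
rewrite (@horner_coef_wide _ n) ?size_prod_but//.
by apply: eq_bigr => m _; rewrite !mxE.
Qed.

(** Determinants commute, so that of the coefficient matrix can be brought next
    to that of the Vandermonde matrix, although diag(1 / (m + 1)) separates the two in the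
    matrix product. *)
Lemma det_prod_but_factor (F : fieldType) n (z : 'rV[F]_n) :
  \det ((\matrix_(i < n, m < n) (prod_but z i)`_m) *m
    diag_mx (\row_(m < n) m.+1%:R^-1) *m Vandermonde n z *m diag_mx (- z)) =
    (n`!%:R)^-1 * (\prod_(j < n) - z 0 j) *
      (\prod_(jk : 'I_n * 'I_n | jk.1 != jk.2) (z 0 jk.2 - z 0 jk.1)).
Proof.
rewrite !det_mulmx [_ * \det (Vandermonde n z)]mulrAC.
rewrite -det_mulmx coef_prod_but_Vandermonde !det_diag.
rewrite -[LHS]mulrA [LHS]mulrC; congr (_ * _ * _).
- under eq_bigr do rewrite mxE.
  by rewrite prodfV fact_prod big_add1 big_mkord natr_prod.
- by apply: eq_bigr => j _; rewrite mxE.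
- under eq_bigr do rewrite mxE.
  rewrite pair_big_dep [LHS](reindex_inj (can_inj (@swap_pairK _ _))).
  by apply: eq_bigl => jk; rewrite /= eq_sym.
Qed.

Theorem theoremA (R : realType) (n : nat) (hn : (0 < n)%N) (z : 'rV[R[i]]_n) :
  \det (theta_jacobian z) =
    (n`!%:R)^-1 * (\prod_(j < n) - z 0 j) *
      (\prod_(jk : 'I_n * 'I_n | jk.1 != jk.2) (z 0 jk.2 - z 0 jk.1))
  /\ (theta_jacobian z \in unitmx <->
        injective (fun j : 'I_n => z 0 j) /\ (forall j : 'I_n, z 0 j != 0)).
Proof.
have detE := det_prod_but_factor z; rewrite -theta_jacobian_factor in detE.
split; first exact: detE.
rewrite unitmxE detE unitfE !mulf_eq0 !negb_or invr_eq0 pnatr_eq0.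
rewrite -lt0n fact_gt0 /=; split.
  case/andP => /prodf_neq0 nz /prodf_neq0 ne; split=> [j k zjk|j].
    apply/eqP; apply: contraT => njk.
    by have := ne (j, k) njk; rewrite /= zjk subrr eqxx.
  by have := nz j isT; rewrite oppr_eq0.
case=> inj nz; apply/andP; split; apply/prodf_neq0.
  by move=> j _; rewrite oppr_eq0.
by case=> j k /= njk; rewrite subr_eq0; apply: contra njk => /eqP/inj ->.
Qed.
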